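(* For every integer $k\ge 1$, every $(=k)$-string graph is also a $(=k+2)$-string graph; that is, the class of $(=k)$-string graphs is a subclass of the class of $(=k+2)$-string graphs.
   Context: Graphs are finite, simple and undirected. A string representation of a graph $G=(V,E)$ is a collection $R=\{R(v): v\in V\}$ of curves in the plane such that for any two distinct vertices $u,v\in V$, $R(u)\cap R(v)\neq\emptyset$ if and only if $\{u,v\}\in E$. A string representation $R$ is proper if every curve in $R$ is a simple piecewise linear curve with finitely many bends, any two curves in $R$ intersect in at most finitely many points, no three curves in $R$ intersect in one point, and no intersection point of two curves coincides with a bend or an endpoint of a curve (so every intersection of two curves is a crossing). For $m\ge 1$, a $(=m)$-string representation is a proper string representation in which any two curves are either disjoint or intersect in precisely $m$ points. A graph is a $(=m)$-string graph if it has a $(=m)$-string representation. *)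

(* Defs.v *)
From HB Require Import structures.
From mathcomp Require Import all_boot all_order all_algebra.
From mathcomp Require Import all_classical all_reals all_analysis.
Set Implicit Arguments.
Unset Strict Implicit.
Unset Printing Implicit Defensive.
Import Order.TTheory GRing.Theory Num.Theory.
Import numFieldNormedType.Exports.
Local Open Scope classical_set_scope.
Local Open Scope card_scope.
Local Open Scope ring_scope.

Record sgraph := SGraph {
  vertex :> finType;
  edge : rel vertex;
  edge_sym : symmetric edge;
  edge_irrefl : irreflexive edge
}.

Definition plane (R : realType) := (R^o * R^o)%type.

(* A curve is given by a parametrization g : R -> plane R, of which only the
   restriction to [0, 1] matters. *)
Definition curve (R : realType) (g : R -> plane R) : Prop :=
  {within `[0, 1], continuous g}.

Definition trace (R : realType) (g : R -> plane R) : set (plane R) :=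
  g @` `[0, 1].

Definition simple_curve (R : realType) (g : R -> plane R) : Prop :=
  curve g /\ {in `[0, 1] &, injective g}.

Definition affine_on (R : realType) (a b : R) (g : R -> plane R) : Prop :=
  exists c d : plane R, {in `[a, b], forall t, g t = c + t *: d}.

(* The subdivision being finite, there are finitely many bends. *)
Definition piecewise_linear (R : realType) (g : R -> plane R) : Prop :=
  exists2 s : seq R, itv_partition 0 1 s &
    forall i, (i < size s)%N ->
      affine_on (nth 0 (0 :: s) i) (nth 0 (0 :: s) i.+1) g.

Definition endpoint (R : realType) (g : R -> plane R) (p : plane R) : Prop :=
  p = g 0 \/ p = g 1.

(* Near the parameter t the curve stays on a single line.  A mere change of
   speed of the parametrization is therefore not a bend. *)
Definition straight_at (R : realType) (g : R -> plane R) (t : R) : Prop :=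
  exists d : plane R, \forall s \near t, exists c : R, g s = g t + c *: d.

Definition bend (R : realType) (g : R -> plane R) (p : plane R) : Prop :=
  exists t : R, [/\ 0 < t < 1, g t = p & ~ straight_at g t].

Definition string_representation (R : realType) (G : sgraph)
    (r : G -> R -> plane R) : Prop :=
  (forall v, curve (r v)) /\
  (forall u v, u != v ->
     (trace (r u) `&` trace (r v) !=set0 <-> edge u v)).

Definition proper_representation (R : realType) (G : sgraph) (r : G -> R -> plane R) : Prop :=
  [/\ forall v, simple_curve (r v) /\ piecewise_linear (r v),
      forall u v, u != v -> finite_set (trace (r u) `&` trace (r v)),
      forall u v w, u != v -> u != w -> v != w ->
        trace (r u) `&` trace (r v) `&` trace (r w) = set0
    & forall u v p, u != v -> (trace (r u) `&` trace (r v)) p ->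
        forall w, ~ bend (r w) p /\ ~ endpoint (r w) p].

Definition exact_string_representation (R : realType) (m : nat) (G : sgraph)
    (r : G -> R -> plane R) : Prop :=
  [/\ string_representation r, proper_representation r
    & forall u v, u != v ->
        trace (r u) `&` trace (r v) = set0 \/
        trace (r u) `&` trace (r v) #= `I_m].

Definition exact_string_graph (R : realType) (m : nat) (G : sgraph) : Prop :=
  exists r : G -> R -> plane R, exact_string_representation m r.

(* Main.v *)
(* At a crossing point p of the curves of u and v, both curves are locally straight, with
   independent directions, and p has a neighbourhood that no other curve meets.  Just
   after p, a short segment of the curve of v is replaced by two sides of a thin triangle
   reaching across the curve of u and back.  This adds exactly two crossings between u
   and v and changes no other intersection.  Since adjacent curves do meet, the move can be
   carried out once for every edge. *)
Require Import Defs.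
From mathcomp Require Import all_boot all_order all_algebra.
From mathcomp Require Import all_classical all_reals all_analysis.
From mathcomp Require Import ring lra.
Set Implicit Arguments.
Unset Strict Implicit.
Unset Printing Implicit Defensive.
Import Order.TTheory GRing.Theory Num.Theory.
Import numFieldNormedType.Exports.
Local Open Scope classical_set_scope.
Local Open Scope card_scope.
Local Open Scope ring_scope.

(** Straightness of a parametrization near its passage through p is not enough for the move: another
    stretch of the same curve might still come back close to p. Injectivity and compactness exclude
    this, so near p the trace of each of the two curves is exactly a line. In the frame spanned by
    these lines every check becomes linear arithmetic. Apart from its ends the detour lies in y > 0,
    where the old curve of v has no nearby point, so the new curve is simple. It crosses the axis x
    = 0, which carries the curve of u, at two heights. Its corners have x different from 0, so no
    other curve passes through them. The detour starts after p, so the crossing p itself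
    survives. *)

(** * Piecewise linearity through unordered breakpoint lists *)

Section PiecewiseLinear.
Variable R : realType.
Implicit Types (g : R -> plane R) (s : seq R) (a b x y t : R).

(* The breakpoints in [s] are unordered and may lie outside [a, b], so that
   refining a subdivision is list concatenation. *)
Definition affine_off s a b g : Prop := forall x y, a <= x -> x < y -> y <= b ->
  (forall z, z \in s -> ~~ (x < z < y)) -> affine_on x y g.

Lemma affine_on_sub a b x y g :
  a <= x -> y <= b -> affine_on a b g -> affine_on x y g.
Proof.
move=> ax yb [c [d gE]]; exists c, d => t; rewrite in_itv /= => /andP[xt ty].
by apply: gE; rewrite in_itv /= (le_trans ax xt) (le_trans ty yb).
Qed.

Lemma partition_gap a x y s : path <%O a s -> a <= x -> x < y -> y <= last a s ->
    (forall z, z \in s -> ~~ (x < z < y)) ->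
  exists2 i, (i < size s)%N & nth 0 (a :: s) i <= x /\ y <= nth 0 (a :: s) i.+1.
Proof.
elim: s a => [|b s IHs] a /=; first by move=> _ ax xy ya; lra.
move=> /andP[ab bs] ax xy yl gap.
have [yb|b_y] := leP y b; first by exists 0%N.
have bx : b <= x by move: (gap b (mem_head _ _)); rewrite b_y andbT -leNgt.
have [z zs|i ilt [ix yi]] := IHs b bs bx xy yl; last by exists i.+1.
by apply: gap; rewrite inE zs orbT.
Qed.

(** Induction on the unsorted list: a breakpoint outside the open interval is dropped, one inside
    splits it, and both halves are treated with the same tail. *)
Lemma affine_off_partition s a b g : a < b -> affine_off s a b g ->
  exists2 t, itv_partition a b t & forall i, (i < size t)%N ->
    affine_on (nth 0 (a :: t) i) (nth 0 (a :: t) i.+1) g.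
Proof.
elim: s a b => [|z s IHs] a b ab off.
  exists [:: b]; first exact: itv_partition1.
  by case=> //= _; apply: off.
have [/andP[az zb]|zNab] := boolP (a < z < b); last first.
  apply: IHs => // x y ax xy yb gap; apply: off => // w.
  rewrite inE => /orP[/eqP->|]; last exact: gap.
  by apply: contra zNab => /andP[xz zy]; rewrite (le_lt_trans ax xz) (lt_le_trans zy yb).
have [t1 part1 aff1] : exists2 t, itv_partition a z t & forall i, (i < size t)%N ->
    affine_on (nth 0 (a :: t) i) (nth 0 (a :: t) i.+1) g.
  apply: IHs => // x y ax xy yz gap; apply: off => //; first exact: le_trans yz (ltW zb).
  move=> w; rewrite inE => /orP[/eqP->|]; last exact: gap.
  by rewrite negb_and -!leNgt yz orbT.
have [t2 part2 aff2] : exists2 t, itv_partition z b t & forall i, (i < size t)%N ->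
    affine_on (nth 0 (z :: t) i) (nth 0 (z :: t) i.+1) g.
  apply: IHs => // x y zx xy yb gap; apply: off => //; first exact: le_trans (ltW az) zx.
  move=> w; rewrite inE => /orP[/eqP->|]; last exact: gap.
  by rewrite negb_and -!leNgt zx.
exists (t1 ++ t2); first exact: itv_partition_cat part1 part2.
move=> i; rewrite size_cat => ilt.
have [i1|i1] := ltnP i (size t1).
  rewrite -cat_cons !nth_cat [size (_ :: _)]/= !ltnS i1 (ltnW i1).
  exact: aff1.
have catE : a :: t1 ++ t2 = belast a t1 ++ z :: t2.
  by case: part1 => _ /eqP<-; rewrite -cat_rcons -lastI.
have nthE j : (size t1 <= j)%N -> nth 0 (a :: t1 ++ t2) j = nth 0 (z :: t2) (j - size t1).
  by move=> j1; rewrite catE nth_cat size_belast ltnNge j1.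
rewrite !nthE ?(leqW i1)// subSn//; apply: aff2.
by rewrite ltn_subLR.
Qed.

Lemma piecewise_linearP g :
  piecewise_linear g <-> exists s, affine_off s 0 1 g.
Proof.
split=> [[s [ps /eqP ls] aff]|[s off]]; last exact: affine_off_partition ltr01 off.
exists s => x y x0 xy y1 gap; have [||i ilt [ix yi]] := partition_gap ps x0 xy => //.
  by rewrite ls.
exact: affine_on_sub ix yi (aff i ilt).
Qed.

Lemma seq_gap_right s t : exists2 b, t < b & forall z, z \in s -> ~~ (t < z < b).
Proof.
elim: s => [|w s [b tb gap]]; first by exists (t + 1) => //; rewrite ltrDl.
have [tw|wt] := ltP t w; last first.
  by exists b => // z; rewrite inE => /orP[/eqP->|/gap//]; rewrite ltNge wt.
exists (Num.min b w) => [|z]; first by rewrite lt_min tb.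
rewrite inE lt_min => /orP[/eqP->|/gap]; first by rewrite ltxx !andbF.
by apply: contra => /and3P[-> -> _].
Qed.

Lemma seq_gap_left s t : exists2 a, a < t & forall z, z \in s -> ~~ (a < z < t).
Proof.
have [b tb gap] := seq_gap_right (map -%R s) (- t).
exists (- b) => [|z zs]; first by rewrite ltrNl.
have /gap : - z \in map -%R s by apply: map_f.
by apply: contra => /andP[bz zt]; rewrite ltrN2 zt ltrNl bz.
Qed.

(** Since [t] may be a breakpoint, the directions on its two sides are found separately; [near_line]
    compares them. *)
Lemma affine_right g t : piecewise_linear g -> 0 <= t -> t < 1 ->
  exists2 b, t < b <= 1 & exists d, {in `[t, b], forall x, g x = g t + (x - t) *: d}.
Proof.
move=> /piecewise_linearP[s off] t0 t1; have [b tb gap] := seq_gap_right s t.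
exists (Num.min b 1); first by rewrite lt_min tb t1 ge_min lexx orbT.
have [||||c [d gE]] := off t (Num.min b 1) => //.
- by rewrite lt_min tb.
- by rewrite ge_min lexx orbT.
- by move=> z /gap; apply: contra => /andP[->]; rewrite lt_min => /andP[].
exists d => x xI; rewrite !gE// ?in_itv/= ?lexx ?le_min ?(ltW tb) ?(ltW t1)//.
by rewrite -addrA -scalerDl; congr (_ + _ *: _); ring.
Qed.

Lemma affine_left g t : piecewise_linear g -> 0 < t -> t <= 1 ->
  exists2 a, 0 <= a < t & exists d, {in `[a, t], forall x, g x = g t + (x - t) *: d}.
Proof.
move=> /piecewise_linearP[s off] t0 t1; have [a ta gap] := seq_gap_left s t.
exists (Num.max a 0); first by rewrite gt_max ta t0 le_max lexx orbT.
have [||||c [d gE]] := off (Num.max a 0) t => //.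
- by rewrite le_max lexx orbT.
- by rewrite gt_max ta.
- by move=> z /gap; apply: contra => /andP[]; rewrite gt_max => /andP[-> _] ->.
exists d => x xI; rewrite !gE// ?in_itv/= ?lexx ?ge_max ?(ltW ta) ?(ltW t0)//.
by rewrite -addrA -scalerDl; congr (_ + _ *: _); ring.
Qed.

End PiecewiseLinear.

(** * The trace of a curve near one of its points *)

Section LocalGeometry.
Variable R : realType.
Implicit Types (g : R -> plane R) (p q d : plane R).

Lemma plane_closed_image g (A : set R) :
  curve g -> A `<=` `[0, 1] -> compact A -> closed (g @` A).
Proof.
move=> cg A01 cA; apply: compact_closed; first exact: norm_hausdorff.
by apply: continuous_compact cA; apply: continuous_subspaceW cg.
Qed.

Lemma near_notin (A : set (plane R)) p : closed A -> ~ A p -> \forall q \near p, ~ A q.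
Proof.
by move=> clA pA; apply: open_nbhs_nbhs; split => //; rewrite openC.
Qed.

Lemma finite_near (A : set (plane R)) p : finite_set A ->
  \forall q \near p, A q -> q = p.
Proof.
move=> finA; have clA : closed (A `\ p).
  apply: (accessible_finite_set_closed.1 _) (finite_setD _ finA).
  by apply: hausdorff_accessible; exact: norm_hausdorff.
have /(near_notin clA) : ~ (A `\ p) p by case=> _; apply.
by apply: filterS => q; apply: contra_notP => /not_implyP[].
Qed.

Lemma near_line_point p d (U : set (plane R)) : d != 0 ->
  (\forall q \near p, U q) -> exists2 c : R, c != 0 & U (p + c *: d).
Proof.
move=> d0 /nbhs_ballP[r /= r0 rU]; have d_gt0 : 0 < `|d| by rewrite normr_gt0.
have c0 : 0 < r / 2 / `|d| by rewrite !divr_gt0.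
exists (r / 2 / `|d|); first by rewrite gt_eqF.
apply: rU; rewrite -ball_normE /ball_ /= opprD addrA subrr sub0r normrN normrZ.
by rewrite gtr0_norm// divfK ?gt_eqF//; lra.
Qed.

(** In a finite set [p] would be isolated, but the line has other points arbitrarily close to
    [p]. *)
Lemma line_germ_infinite p d (A : set (plane R)) : d != 0 ->
  (\forall q \near p, (exists c, q = p + c *: d) -> A q) -> ~ finite_set A.
Proof.
move=> d0 pA /finite_near-/(_ p) Ap.
have [c c0 [H1 H2]] := near_line_point d0 (filterI pA Ap).
have /eqP : p + c *: d = p by apply: H2; apply: H1; exists c.
by rewrite eq_sym addrC -subr_eq subrr eq_sym scaler_eq0 (negbTE c0) (negbTE d0).
Qed.

(** [straight_at] only says that nearby times stay on a line. Here the whole trace is compared with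
    that line, in both directions. The vector [d] is the velocity just after [t]; the velocity [d1]
    just before is shown to be a positive multiple [l] of it. *)
Lemma near_line g t : simple_curve g -> piecewise_linear g -> 0 < t < 1 ->
    straight_at g t ->
  exists d b, [/\ d != 0, t < b <= 1, {in `[t, b], forall x, g x = g t + (x - t) *: d}
    & \forall q \near g t, trace g q <-> exists c, q = g t + c *: d].
Proof.
move=> [cg ig] pg /andP[t0 t1] [d0 /nbhs_ballP[e /= e0 line]].
have [b /andP[tb b1] [d gr]] := affine_right pg (ltW t0) t1.
have [a /andP[a0 at_] [d1 gl]] := affine_left pg t0 (ltW t1).
have tI : t \in `[0, 1] by rewrite in_itv /= !ltW.
have gN x : 0 <= x -> x <= 1 -> x != t -> g x != g t.
  move=> x0 x1; apply: contraNneq => /ig -> //.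
  by rewrite in_itv /= x0.
have dn0 : d != 0.
  have := gN b (le_trans (ltW t0) (ltW tb)) b1; rewrite gt_eqF// => /(_ isT).
  rewrite gr ?in_itv/= ?lexx ?(ltW tb)//.
  by apply: contraNneq => ->; rewrite scaler0 addr0.
have [k d0E] : exists k, d0 = k *: d.
  pose x := t + Num.min (e / 2) (b - t).
  have xt : 0 < Num.min (e / 2) (b - t) by rewrite lt_min subr_gt0 tb divr_gt0.
  have xI : x \in `[t, b].
    rewrite in_itv /= lerDl (ltW xt) /= -lerBrDl ge_min lexx orbT //.
  have [|c gx] := line x.
    rewrite -ball_normE /ball_ /= /x opprD addrA subrr sub0r normrN gtr0_norm//.
    by rewrite gt_min; apply/orP; left; lra.
  have cn0 : c != 0.
    move: xI (gN x); rewrite in_itv /= => /andP[tx xb] /(_ (le_trans (ltW t0) tx) (le_trans xb b1)).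
    rewrite gt_eqF ?ltrDl// => /(_ isT); apply: contraNneq => c0.
    by rewrite gx c0 scale0r addr0.
  exists (c^-1 * (x - t)).
  move: gx; rewrite (gr _ xI) => /addrI; rewrite -scalerA => ->.
  by rewrite scalerA mulVf// scale1r.
have [l d1E] : exists l, d1 = l *: d.
  pose x := t - Num.min (e / 2) (t - a).
  have xt : 0 < Num.min (e / 2) (t - a) by rewrite lt_min subr_gt0 at_ divr_gt0.
  have xI : x \in `[a, t].
    by rewrite in_itv /= gerBl (ltW xt) andbT lerBrDr -lerBrDl ge_min lexx orbT.
  have [|c gx] := line x.
    rewrite -ball_normE /ball_ /= /x opprB addrC subrK gtr0_norm//.
    by rewrite gt_min; apply/orP; left; lra.
  exists ((x - t)^-1 * (c * k)).
  move: gx; rewrite (gl _ xI) => /addrI; rewrite d0E -!scalerA => <-.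
  by rewrite scalerA mulVf ?scale1r// subr_eq0 lt_eqF// gtrBl.
(* Otherwise the curve folds back at [t], or stands still before it, and the times [t - x] and
   [t - x * l] give the same point. Dividing by [1 - l] rather than [- l] also covers [l = 0]. *)
have l0 : 0 < l.
  rewrite ltNge; apply/negP => l0.
  pose x := Num.min (t - a) ((b - t) / (1 - l)).
  have l1 : 0 < 1 - l by lra.
  have x0 : 0 < x by rewrite lt_min subr_gt0 at_ divr_gt0// subr_gt0.
  have xa : x <= t - a by rewrite ge_min lexx.
  have xb : x * (1 - l) <= b - t by rewrite -ler_pdivlMr// ge_min lexx orbT.
  have xl : 0 <= - (x * l) by rewrite -mulrN mulr_ge0 ?oppr_ge0 ?(ltW x0).
  have E1 : g (t - x) = g (t - x * l).
    rewrite (gl (t - x)); last by rewrite in_itv /=; apply/andP; split; lra.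
    rewrite (gr (t - x * l)); last by rewrite in_itv /=; apply/andP; split; lra.
    by rewrite d1E scalerA; congr (_ + _ *: _); ring.
  have : t - x = t - x * l.
    by apply: ig E1; rewrite in_itv /=; apply/andP; split; lra.
  by lra.
exists d, b; split; rewrite ?tb//.
(* The remaining times form a compact set without [t]; by injectivity its closed image misses [g t],
   hence a neighbourhood of it. *)
pose A : set R := `[0, a] `|` `[b, 1].
have clA : closed (g @` A).
  apply: plane_closed_image => //; last by apply: compactU; exact: segment_compact.
  by move=> x [] /=; rewrite !in_itv /= => /andP[? ?]; apply/andP; split; lra.
have gtA : ~ (g @` A) (g t).
  move=> [x Ax /ig xt]; have {xt}xt : x = t.
    apply: xt => //; case: Ax => /=; rewrite !in_itv /= => /andP[? ?]; apply/andP; split; lra.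
  by move: Ax; rewrite xt => -[] /=; rewrite in_itv /= => /andP[? ?]; lra.
(* Within this radius the point with coefficient [c] is reached before time [b] or after time [a]:
   at [t + c] if [c] is nonnegative, at [t + c / l] otherwise. *)
have r0 : 0 < `|d| * Num.min (b - t) (l * (t - a)).
  by rewrite mulr_gt0 ?normr_gt0// lt_min subr_gt0 tb mulr_gt0// subr_gt0.
near=> q; split.
- move=> [x /= x01 gx].
  have [xt|tx] := lerP x t.
    rewrite -gx gl ?d1E; first by exists ((x - t) * l); rewrite scalerA.
    rewrite in_itv /= xt andbT leNgt; apply/negP => xa.
    have : ~ (g @` A) q by near: q; apply: near_notin.
    apply; exists x => //; left; rewrite /= in_itv /=.
    by move: x01; rewrite in_itv /= => /andP[-> _] /=; exact: ltW.
  rewrite -gx gr; first by exists (x - t).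
  rewrite in_itv /= (ltW tx) leNgt; apply/negP => xb.
  have : ~ (g @` A) q by near: q; apply: near_notin.
  apply; exists x => //; right; rewrite /= in_itv /=.
  by move: x01; rewrite in_itv /= (ltW xb) => /andP[_ ->].
- move=> [c qE].
  have : ball (g t) (`|d| * Num.min (b - t) (l * (t - a))) q.
    by near: q; exact: nbhsx_ballx.
  rewrite -ball_normE /ball_ /= qE opprD addrA subrr sub0r normrN normrZ mulrC.
  rewrite ltr_pM2l ?normr_gt0// lt_min => /andP[cb ca].
  have [c0|c0] := lerP 0 c.
    rewrite ger0_norm// in cb.
    exists (t + c); first by rewrite /= in_itv /=; apply/andP; split; lra.
    rewrite gr; last by rewrite in_itv /=; apply/andP; split; lra.
    by congr (_ + _ *: _); ring.
  rewrite ltr0_norm// mulrC -ltr_pdivrMr// mulNr in ca.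
  have cl : c / l < 0 by rewrite pmulr_llt0 // invr_gt0.
  exists (t + c / l); first by rewrite /= in_itv /=; apply/andP; split; lra.
  rewrite gl; last by rewrite in_itv /=; apply/andP; split; lra.
  rewrite d1E scalerA; congr (_ + _ *: _).
  by rewrite [t + _]addrC addrK divfK ?gt_eqF.
Unshelve. all: by end_near. Qed.

End LocalGeometry.

(** * Criteria for straightness and for the absence of bends *)

Section Straight.
Variable R : realType.
Implicit Types (g : R -> plane R) (p q d : plane R) (a b t : R).

Lemma affine_on_straight g a b t : affine_on a b g -> a < t < b -> straight_at g t.
Proof.
move=> [c [d gE]] tI; exists d.
have aE x : x \in `]a, b[ -> g x = c + x *: d by move=> xI; apply/gE/subset_itv_oo_cc.
have itI : t \in `]a, b[ by rewrite in_itv.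
near=> x; exists (x - t); rewrite !aE//; first by rewrite -addrA -scalerDl [t + _]addrC subrK.
near: x; exact: near_in_itvoo.
Unshelve. all: by end_near. Qed.

Lemma straight_at_near g g' t :
  (\forall x \near t, g' x = g x) -> straight_at g t -> straight_at g' t.
Proof.
move=> gg' [d sg]; exists d; have := nbhs_singleton gg' => ->.
near=> x; have -> : g' x = g x by near: x.
by near: x.
Unshelve. all: by end_near. Qed.

(** By continuity, times near a passage through [q] give points near [q], hence on the line. The
    base point [p] need not be [q]: the line is the one through the old crossing, while [q] will be
    a new one. *)
Lemma trace_line_no_bend g q d p : curve g ->
  (\forall q' \near q, trace g q' -> exists c, q' = p + c *: d) -> ~ bend g q.
Proof.
move=> cg line [t [t01 gt]]; apply; exists d.
have ct : {for t, continuous g} by apply: within_continuous_continuous cg _.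
have tI : t \in `]0, 1[ by rewrite in_itv.
have pull x : (trace g (g x) -> exists c, g x = p + c *: d) -> x \in `]0, 1[ ->
    exists c, g x = p + c *: d.
  by move=> H xI; apply: H; exists x => //; apply: subset_itv_oo_cc xI.
rewrite -gt in line; have [c gc] := pull t (nbhs_singleton line) tI.
near=> x; have [||c' gc'] := pull x; first by near: x; exact: (ct _ line).
  by near: x; exact: near_in_itvoo.
by exists (c' - c); rewrite gc gc' -addrA -scalerDl [c + _]addrC subrK.
Unshelve. all: by end_near. Qed.

End Straight.

(* A finger move: in the affine frame (p, D, E), where the curve runs along the
   first axis at speed 1 / tau on the time interval [t0, t0 + 2 tau], the piece from (1, 0) to
   (2, 0) is replaced by the two segments (1, 0) -- (-1, 1) -- (2, 0), which cross the
   second axis at heights 1/2 and 2/3.  The displacement E - 5/2 D is the one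
   taking the midpoint (3/2, 0) to the apex (-1, 1). *)
Section Finger.
Variables (R : realType) (g : R -> plane R) (t0 tau : R) (p D E : plane R).

Definition frame_point (x y : R) : plane R := p + x *: D + y *: E.
Let pt := frame_point.
Let s (t : R) := (t - t0) / tau.

(** A hat of height 1 over the rescaled times 1 to 2. Adding a multiple of a fixed vector makes the
    new curve continuous without any gluing. *)
Definition tent (t : R) : R := Num.max 0 (1 - `|(t - t0) / tau - 3 / 2| * 2).
Definition finger (t : R) : plane R := g t + tent t *: (E - (5 / 2) *: D).

Hypotheses (tau_gt0 : 0 < tau) (t0_gt0 : 0 < t0) (t0_lt1 : t0 + 2 * tau < 1).
Hypotheses (g_simple : simple_curve g) (g_pl : piecewise_linear g).
Hypothesis g_axis : forall t, 0 <= s t <= 2 -> g t = pt (s t) 0.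
Hypothesis pt_inj : forall x y x' y', pt x y = pt x' y' -> x = x' /\ y = y'.
(** The box contains the detour, where x runs from -1 to 2 and y from 0 to 1. This hypothesis keeps
    the detour away from the rest of the curve. *)
Hypothesis g_frame : forall x y, `|x| <= 3 -> 0 <= y <= 1 -> trace g (pt x y) -> y = 0.

Lemma tent_out t : s t <= 1 \/ 2 <= s t -> tent t = 0.
Proof.
rewrite /tent -/(s t) => H; apply/max_idPl; case: H => H.
  by rewrite ler0_norm; lra.
by rewrite ger0_norm; lra.
Qed.

Lemma tent_up t : 1 <= s t <= 3 / 2 -> tent t = 2 * s t - 2.
Proof.
rewrite /tent -/(s t) => /andP[H1 H2]; rewrite ler0_norm; last lra.
rewrite (max_idPr _); lra.
Qed.

Lemma tent_down t : 3 / 2 <= s t <= 2 -> tent t = 4 - 2 * s t.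
Proof.
rewrite /tent -/(s t) => /andP[H1 H2]; rewrite ger0_norm; last lra.
rewrite (max_idPr _); lra.
Qed.

Lemma finger_out t : s t <= 1 \/ 2 <= s t -> finger t = g t.
Proof. by move=> /tent_out h; rewrite /finger h scale0r addr0. Qed.

Lemma frame_point_shift x y h :
  pt x y + h *: (E - (5 / 2) *: D) = pt (x - 5 / 2 * h) (y + h).
Proof.
rewrite /pt /frame_point; apply: injective_projections;
rewrite /= /GRing.scale /=; ring.
Qed.

Lemma finger_up t : 1 <= s t <= 3 / 2 ->
  finger t = pt (1 - 2 * (2 * s t - 2)) (2 * s t - 2).
Proof.
move=> tI; rewrite /finger tent_up// g_axis; last by lra.
by rewrite frame_point_shift; congr pt; field.
Qed.

Lemma finger_down t : 3 / 2 <= s t <= 2 ->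
  finger t = pt (2 - 3 * (4 - 2 * s t)) (4 - 2 * s t).
Proof.
move=> tI; rewrite /finger tent_down// g_axis; last by lra.
by rewrite frame_point_shift; congr pt; field.
Qed.

(** The height [y] serves as coordinate on either side of the triangle. Recording the time as well
    lets injectivity be read off by linear arithmetic. *)
Lemma finger_in t : 1 < s t < 2 -> exists2 y, 0 < y <= 1 &
  (finger t = pt (1 - 2 * y) y /\ s t = 1 + y / 2) \/
  (finger t = pt (2 - 3 * y) y /\ s t = 2 - y / 2).
Proof.
move=> /andP[t1 t2]; have [t32|t32] := lerP (s t) (3 / 2).
  exists (2 * s t - 2); first lra.
  by left; split; [apply: finger_up; lra|lra].
exists (4 - 2 * s t); first lra.
by right; split; [apply: finger_down; lra|lra].
Qed.

Lemma timeE t : t = t0 + s t * tau.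
Proof. by rewrite /s divfK ?gt_eqF// addrC subrK. Qed.

Lemma le_time c t : (c <= s t) = (t0 + c * tau <= t).
Proof. by rewrite /s ler_pdivlMr// lerBrDl. Qed.

Lemma ge_time c t : (s t <= c) = (t <= t0 + c * tau).
Proof. by rewrite /s ler_pdivrMr// lerBlDl. Qed.

Lemma lt_time c t : (c < s t) = (t0 + c * tau < t).
Proof. by rewrite /s ltr_pdivlMr// ltrBrDl. Qed.

Lemma gt_time c t : (s t < c) = (t < t0 + c * tau).
Proof. by rewrite /s ltr_pdivrMr// ltrBlDl. Qed.

Lemma time_itv t : 0 <= s t <= 2 -> 0 < t < 1.
Proof.
rewrite le_time ge_time => /andP[t1 t2]; rewrite mul0r addr0 in t1.
by rewrite (lt_le_trans t0_gt0 t1) (le_lt_trans t2 t0_lt1).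
Qed.

Lemma finger_near x : 1 < s x < 2 -> exists x' y, [/\ `|x'| <= 3, 0 < y <= 1 & finger x = pt x' y].
Proof.
move=> /finger_in[y /andP[y0 y1] [[fE _]|[fE _]]].
  by exists (1 - 2 * y), y; split => //; rewrite ?y0// ler_norml; apply/andP; split; lra.
by exists (2 - 3 * y), y; split => //; rewrite ?y0// ler_norml; apply/andP; split; lra.
Qed.

Lemma time_trichotomy t : s t <= 1 \/ 2 <= s t \/ 1 < s t < 2.
Proof.
by have [?|?] := lerP (s t) 1; [left|have [?|?] := lerP 2 (s t); right; [left|right; apply/andP]].
Qed.

(** An old point cannot be a detour point, which has positive height. The two sides 1 - 2y and 2 -
    3y agree only at y = 1, the apex, where both times are 3/2. *)
Lemma finger_inj : {in `[0, 1] &, injective finger}.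
Proof.
have mixed t t' : t \in `[0, 1] -> (s t <= 1 \/ 2 <= s t) -> 1 < s t' < 2 -> finger t <> finger t'.
  move=> tI tout tin; rewrite finger_out//.
  have [x [y [x3 /andP[y0 y1] ->]]] := finger_near tin => gE.
  have := @g_frame x y x3; rewrite (ltW y0) y1 => /(_ isT).
  have tr : trace g (pt x y) by exists t.
  by move=> /(_ tr) y00; rewrite y00 ltxx in y0.
have split t : (s t <= 1 \/ 2 <= s t) \/ 1 < s t < 2.
  by have [?|[?|?]] := time_trichotomy t; tauto.
move=> t t' tI tI'; have [tout|tin] := split t; have [tout'|tin'] := split t'.
- by rewrite !finger_out//; apply: g_simple.2.
- by move=> /mixed; case.
- by move=> /esym /mixed; case.
have [y /andP[y0 y1] H] := finger_in tin; have [y' /andP[y0' y1'] H'] := finger_in tin'.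
move=> fE; rewrite (timeE t) (timeE t'); congr (_ + _ * _).
move: H H'; rewrite fE => -[[-> st]|[-> st]] [[/pt_inj[xE yE] st']|[/pt_inj[xE yE] st']]; lra.
Qed.

Lemma finger_curve : curve finger.
Proof.
rewrite /curve (_ : finger = g + (fun t => tent t *: (E - (5 / 2) *: D)))//.
apply: within_continuousD; first exact: g_simple.1.
apply: continuous_subspaceT => t; apply: continuousZr_tmp.
apply: (@continuous_max _ _ (cst 0) (fun t => 1 - `|(t - t0) / tau - 3 / 2| * 2)).
  exact: cst_continuous.
apply: continuousB; first exact: cst_continuous.
apply: continuousM; last exact: cst_continuous.
apply: (continuous_comp _ (@norm_continuous _ _ _)).
apply: continuousB; last exact: cst_continuous.
apply: continuousM; last exact: cst_continuous.
by apply: continuousB; [exact: id|exact: cst_continuous].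
Qed.

Lemma finger_affine a b m k : affine_on a b g ->
  (forall t, a <= t <= b -> tent t = k + m * s t) -> affine_on a b finger.
Proof.
move=> [c [d gE]] tentE.
exists (c + (k - m * t0 / tau) *: (E - (5 / 2) *: D)),
  (d + (m / tau) *: (E - (5 / 2) *: D)).
move=> t tI.
rewrite /finger gE// tentE//; apply: injective_projections;
rewrite /= /GRing.scale /= /s; ring.
Qed.

Lemma finger_pl : piecewise_linear finger.
Proof.
have /piecewise_linearP[l off] := g_pl; apply/piecewise_linearP.
exists ([:: t0 + 1 * tau; t0 + 3 / 2 * tau; t0 + 2 * tau] ++ l) => x y x0 xy y1 gap.
have aff : affine_on x y g.
  by apply: off => // z zl; apply: gap; rewrite mem_cat zl orbT.
have cut c : c \in [:: 1; 3 / 2; 2] -> s y <= c \/ c <= s x.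
  move=> cI; have /gap : t0 + c * tau \in [:: t0 + 1 * tau; t0 + 3 / 2 * tau; t0 + 2 * tau] ++ l.
    by rewrite mem_cat; move: cI; rewrite !inE => /or3P[] /eqP ->; rewrite eqxx ?orbT.
  by rewrite negb_and -!leNgt ge_time le_time => /orP[]; [right|left].
have mono t t' : t <= t' -> s t <= s t'.
  by move=> tt'; rewrite /s ler_pM2r ?invr_gt0// lerB.
have tb t : x <= t <= y -> s x <= s t <= s y by move=> /andP[/mono-> /mono->].
have [c1|c1] := cut 1 (mem_head _ _).
  apply: (@finger_affine _ _ 0 0 aff) => t /tb/andP[? ?].
  by rewrite mul0r addr0 tent_out//; left; lra.
have [|c2|c2] := cut (3 / 2); first by rewrite !inE eqxx orbT.
  apply: (@finger_affine _ _ 2 (- 2) aff) => t /tb/andP[? ?].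
  by rewrite tent_up; lra.
have [|c3|c3] := cut 2; first by rewrite !inE eqxx !orbT.
  apply: (@finger_affine _ _ (- 2) 4 aff) => t /tb/andP[? ?].
  by rewrite tent_down; lra.
apply: (@finger_affine _ _ 0 0 aff) => t /tb/andP[? ?].
by rewrite mul0r addr0 tent_out//; right; lra.
Qed.

Lemma finger_simple : simple_curve finger.
Proof. by split; [exact: finger_curve|exact: finger_inj]. Qed.

Lemma finger_endpoint q : endpoint finger q -> endpoint g q.
Proof.
have s0 : s 0 <= 1 by rewrite ge_time mul1r addr_ge0 // ltW.
have s1 : 2 <= s 1 by rewrite le_time ltW.
by rewrite /endpoint !finger_out; tauto.
Qed.

Lemma g_affine_axis : affine_on (t0 + 0 * tau) (t0 + 2 * tau) g.
Proof.
exists (p - (t0 / tau) *: D), (tau^-1 *: D) => t; rewrite in_itv /= -le_time -ge_time => tI.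
rewrite g_axis// /pt /frame_point; apply: injective_projections;
rewrite /= /GRing.scale /= /s; ring.
Qed.

(** The possible new bends are the corners (1, 0), (-1, 1) and (2, 0). Only [x != 0] is kept, since
    in the box the other curves reduce to the second axis. *)
Lemma finger_bend q : bend finger q ->
  bend g q \/ exists x y, [/\ q = pt x y, `|x| <= 3, 0 <= y <= 1 & x != 0].
Proof.
move=> [t [t01 fq nst]].
have n1 x : `|x| <= 3 -> x != 0 -> g t = pt x 0 -> finger t = g t ->
    exists x y, [/\ q = pt x y, `|x| <= 3, 0 <= y <= 1 & x != 0].
  by move=> x3 x0 gt ft; exists x, 0; rewrite -fq ft lexx ler01.
have out : s t < 1 \/ 2 < s t -> bend g q.
  move=> tout; exists t; split => //.
    by rewrite -fq finger_out//; case: tout => /ltW; [left|right].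
  apply: contra_not nst; apply: straight_at_near.
  case: tout; [rewrite gt_time|rewrite lt_time] => tout.
    near=> x; apply: finger_out; left; rewrite ge_time; apply: ltW; near: x.
    exact: lt_nbhsl.
  near=> x; apply: finger_out; right; rewrite le_time; apply: ltW; near: x.
  exact: lt_nbhsr.
have [t1|t1|t1] := ltgtP (s t) 1; first by left; apply: out; left.
  have [t2|t2|t2] := ltgtP (s t) 2; last 2 first.
  - by left; apply: out; right.
  - right; apply: (n1 2); first by rewrite ger0_norm; lra.
    + by rewrite pnatr_eq0.
    + by rewrite g_axis t2 ?lexx ?ler0n.
    + by rewrite finger_out// t2; right.
  have [t3|t3|t3] := ltgtP (s t) (3 / 2).
  - exfalso; apply: nst; apply: (@affine_on_straight _ _ (t0 + 1 * tau) (t0 + 3 / 2 * tau)).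
      apply: (@finger_affine _ _ 2 (- 2)).
        by apply: affine_on_sub g_affine_axis; rewrite lerD2l ler_pM2r//; lra.
      by move=> x; rewrite -le_time -ge_time => ?; rewrite tent_up; lra.
    by rewrite -lt_time -gt_time t1 t3.
  - exfalso; apply: nst; apply: (@affine_on_straight _ _ (t0 + 3 / 2 * tau) (t0 + 2 * tau)).
      apply: (@finger_affine _ _ (- 2) 4).
        by apply: affine_on_sub g_affine_axis; rewrite lerD2l ler_pM2r//; lra.
      by move=> x; rewrite -le_time -ge_time => ?; rewrite tent_down; lra.
    by rewrite -lt_time -gt_time t2 t3.
  right; exists (- 1), 1; split.
  - by rewrite -fq finger_up ?t3; [congr pt; lra|apply/andP; split; lra].
  - by rewrite normrN1; lra.
  - by rewrite ler01 lexx.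
  - by rewrite oppr_eq0 oner_eq0.
right; apply: (n1 1); first by rewrite normr1; lra.
- by rewrite oner_eq0.
- by rewrite g_axis t1 ?ler01 ?ler1n.
- by rewrite finger_out// t1; left.
Unshelve. all: by end_near. Qed.

Lemma trace_finger q : trace finger q -> trace g q \/
  exists x y, [/\ q = pt x y, `|x| <= 3, 0 <= y <= 1 & x = 0 -> y = 1 / 2 \/ y = 2 / 3].
Proof.
move=> [t tI <-].
have [tout|[tout|]] := time_trichotomy t; try by left; exists t => //; rewrite finger_out; tauto.
move=> /finger_in[y /andP[y0 y1] [[fE _]|[fE _]]]; right.
  exists (1 - 2 * y), y; split => //; rewrite ?y1 ?(ltW y0)//; last by move=> ?; lra.
  by rewrite ler_norml; apply/andP; split; lra.
exists (2 - 3 * y), y; split => //; rewrite ?y1 ?(ltW y0)//; last by move=> ?; lra.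
by rewrite ler_norml; apply/andP; split; lra.
Qed.

(** The removed points have x strictly between 1 and 2, so no crossing on the second axis is lost,
    in particular not the one at [p]. *)
Lemma trace_finger_old q : trace g q ->
  trace finger q \/ exists x, [/\ q = pt x 0, `|x| <= 3 & x != 0].
Proof.
move=> [t tI <-].
have [tout|[tout|]] := time_trichotomy t; try by left; exists t => //; rewrite finger_out; tauto.
move=> /andP[t1 t2]; right; exists (s t); rewrite g_axis; last lra.
by split => //; [rewrite ger0_norm; lra|rewrite gt_eqF; lra].
Qed.

Lemma trace_finger_new y : y = 1 / 2 \/ y = 2 / 3 -> trace finger (pt 0 y).
Proof.
have sE c : s (t0 + c * tau) = c by rewrite /s addrAC subrr add0r mulfK ?gt_eqF.
have cI c : 0 <= c <= 2 -> (`[0, 1]%classic : set R) (t0 + c * tau).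
  rewrite -{1 2}(sE c) => /time_itv/andP[? ?].
  by rewrite /= in_itv /=; apply/andP; split; exact: ltW.
case=> ->.
  (* The rescaled times are 1 + y/2 for y = 1/2 on the way up and 2 - y/2 for y = 2/3 on the way
     down. *)
  exists (t0 + 5 / 4 * tau); first by apply: cI; lra.
  by rewrite finger_up sE; [congr pt; field|lra].
exists (t0 + 5 / 3 * tau); first by apply: cI; lra.
by rewrite finger_down sE; [congr pt; field|lra].
Qed.

End Finger.

(** * An affine frame at a crossing *)

Section CrossingFrame.
Variable R : realType.
Implicit Types (g h : R -> plane R) (p q d e : plane R).

Lemma interior_time g p : trace g p -> ~ endpoint g p -> ~ bend g p ->
  exists t, [/\ 0 < t < 1, g t = p & straight_at g t].
Proof.
move=> [t /=]; rewrite in_itv /= => /andP[t0 t1] gt Nend Nbend.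
have tn0 : t != 0 by apply: contra_notN Nend => /eqP t_0; left; rewrite -gt t_0.
have tn1 : t != 1 by apply: contra_notN Nend => /eqP t_1; right; rewrite -gt t_1.
have t01 : 0 < t < 1 by rewrite !lt_def tn0 t0 t1 eq_sym tn1.
by exists t; split => //; apply: contra_notP Nbend => ?; exists t.
Qed.

(* Parallel germs would share a segment, hence infinitely many points. *)
Lemma crossing_independent g h p d e : d != 0 -> e != 0 ->
    (\forall q \near p, trace g q <-> exists c, q = p + c *: d) ->
    (\forall q \near p, trace h q <-> exists c, q = p + c *: e) ->
    finite_set (trace g `&` trace h) ->
  forall x y, x *: d + y *: e = 0 -> x = 0 /\ y = 0.
Proof.
move=> d0 e0 gp hp fin x y xy0.
have y00 : y = 0 -> x = 0.
  by move=> y0; move/eqP: xy0; rewrite y0 scale0r addr0 scaler_eq0 (negbTE d0) orbF => /eqP.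
have [y0|yn0] := eqVneq y 0; first by rewrite y00.
exfalso; apply: (line_germ_infinite d0 _ fin).
have eE : e = - (x / y) *: d.
  have ye : y *: e = - x *: d by apply/eqP; rewrite scaleNr -addr_eq0 addrC xy0.
  by rewrite -mulNr mulrC -scalerA -ye scalerA mulVf// scale1r.
have xn0 : x != 0.
  by apply: contra_neq e0 => x0; rewrite eE x0 mul0r oppr0 scale0r.
apply: filterS2 gp hp => q gq hq [c qE]; split; first by apply/gq; exists c.
apply/hq; exists (- (c * y / x)); rewrite qE eE scalerA; congr (_ + _ *: _).
by field; rewrite xn0 yn0.
Qed.

(** The detour starts after [p], so the parametrization of [g] is needed only forward in time,
    whereas both traces are needed on the whole box. The last clause serves to exclude bends of [h]
    at the new crossings. *)
Lemma crossing_frame g h p (U : set (plane R)) :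
    simple_curve g -> piecewise_linear g -> simple_curve h -> piecewise_linear h ->
    finite_set (trace g `&` trace h) -> trace g p -> trace h p ->
    ~ endpoint g p -> ~ bend g p -> ~ endpoint h p -> ~ bend h p ->
    (\forall q \near p, U q) ->
  exists t0 tau D E,
    [/\ [/\ 0 < tau, 0 < t0 & t0 + 2 * tau < 1],
        forall t, 0 <= (t - t0) / tau <= 2 -> g t = frame_point p D E ((t - t0) / tau) 0,
        forall x y x' y', frame_point p D E x y = frame_point p D E x' y' -> x = x' /\ y = y'
      & forall x y, `|x| <= 3 -> `|y| <= 1 ->
          [/\ trace g (frame_point p D E x y) -> y = 0,
              trace h (frame_point p D E x y) <-> x = 0,
              U (frame_point p D E x y)
            & \forall q \near frame_point p D E x y,
                trace h q -> exists c, q = p + c *: E]].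
Proof.
move=> sg pg sh ph fin gp hp Neg Nbg Neh Nbh Up.
have [t0 [/andP[t0_gt0 t0_lt1] gt0 stg]] := interior_time gp Neg Nbg.
have [t1 [t1I ht1 sth]] := interior_time hp Neh Nbh.
have [|d [b [d0 /andP[t0b b1] gr gline]]] := near_line sg pg _ stg; first by rewrite t0_gt0.
have [e [_ [e0 _ _ hline]]] := near_line sh ph t1I sth.
rewrite gt0 in gr gline; rewrite ht1 in hline.
have indep := crossing_independent d0 e0 gline hline fin.
have [r /= r0 rU] := (nbhs_ballP _ _).1 (filterI (filterI gline hline) Up).
have de0 : 0 < `|d| + `|e| by rewrite ltr_pwDl ?normr_gt0.
(* The first bound gives t0 + 2 tau < b. The second puts the box, whose points are within 3 tau |d|
   + tau |e| of [p], strictly inside the ball of radius [r]. *)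
pose tau := Num.min ((b - t0) / 3) (r / (4 * (`|d| + `|e|))).
have tau0 : 0 < tau by rewrite lt_min !divr_gt0 ?subr_gt0// mulr_gt0.
have taub : tau <= (b - t0) / 3 by rewrite ge_min lexx.
have taur : 4 * (tau * (`|d| + `|e|)) <= r.
  by rewrite mulrCA -ler_pdivlMr ?mulr_gt0// ge_min lexx orbT.
have tn0 : tau != 0 by rewrite gt_eqF.
pose D := tau *: d; pose E := tau *: e.
have ptE x y : frame_point p D E x y = p + (x * tau *: d + y * tau *: e).
  by rewrite /frame_point /D /E !scalerA addrA.
have inj x y x' y' : p + (x *: d + y *: e) = p + (x' *: d + y' *: e) -> x = x' /\ y = y'.
  move=> /addrI /eqP; rewrite -subr_eq0 opprD addrACA -!scalerBl => /eqP /indep[].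
  by move=> /eqP + /eqP; rewrite !subr_eq0 => /eqP -> /eqP ->.
exists t0, tau, D, E; split.
- by split => //; lra.
- move=> t; rewrite ler_pdivlMr// ler_pdivrMr// mul0r => /andP[H1 H2].
  rewrite ptE divfK// mul0r scale0r addr0 gr// in_itv /=; apply/andP; split; lra.
- move=> x y x' y'; rewrite !ptE => /inj[].
  by move=> /(mulIf tn0) -> /(mulIf tn0) ->.
- move=> x y x3 y1.
  have inr : ball p r (frame_point p D E x y).
    rewrite -ball_normE /ball_ /= ptE opprD addrA subrr sub0r normrN.
    apply: le_lt_trans (ler_normD _ _) _; rewrite !normrZ (gtr0_norm tau0).
    have H1 : `|x| * tau * `|d| <= 3 * (tau * `|d|).
      by rewrite -mulrA ler_wpM2r// mulr_ge0// ltW.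
    have H2 : `|y| * tau * `|e| <= 1 * (tau * `|e|).
      by rewrite -mulrA ler_wpM2r// mulr_ge0// ltW.
    have H3 : 0 <= tau * `|e| by rewrite mulr_ge0// ltW.
    by move: taur r0; rewrite mulrDr; lra.
  have [[gl hl] Uq] := rU _ inr; split => //.
  + rewrite gl ptE => -[c]; rewrite -[c *: d]addr0 -(scale0r e) => /inj[_ /eqP].
    by rewrite mulf_eq0 (negbTE tn0) orbF => /eqP.
  + rewrite hl ptE; split.
      move=> [c]; rewrite -[c *: e]add0r -(scale0r d) => /inj[/eqP + _].
      by rewrite mulf_eq0 (negbTE tn0) orbF => /eqP.
    by move=> ->; exists (y * tau); rewrite mul0r scale0r add0r.
  + have : nbhs (frame_point p D E x y) (ball p r).
      by apply: open_nbhs_nbhs; split => //; exact: ball_open.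
    apply: filterS => q /rU[[_ ->] _] [c ->]; exists (c / tau).
    by rewrite /E scalerA divfK.
Qed.

End CrossingFrame.

(** * Rerouting one curve of a representation *)

Section Representation.
Variables (R : realType) (G : sgraph).
Implicit Types (r : G -> R -> plane R) (u v w : G).

Lemma bend_trace (g : R -> plane R) p : bend g p -> trace g p.
Proof.
by move=> [t [/andP[t0 t1] <- _]]; exists t => //=; rewrite in_itv /= !ltW.
Qed.

Lemma endpoint_trace (g : R -> plane R) p : endpoint g p -> trace g p.
Proof.
by case=> ->; [exists 0|exists 1] => //=; rewrite in_itv /= lexx ler01.
Qed.

(** Only the curve of [v] changes. The last clause treats all curves [w'] because properness forbids
    a bend or endpoint of any curve at a crossing. *)
Lemma add_two_crossings r u v : proper_representation r -> u != v ->
    trace (r v) `&` trace (r u) !=set0 ->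
  exists g, [/\ simple_curve g /\ piecewise_linear g,
    forall w, w != v -> w != u -> trace g `&` trace (r w) = trace (r v) `&` trace (r w),
    exists q1 q2, [/\ q1 != q2, ~ trace (r v) q1, ~ trace (r v) q2
      & trace g `&` trace (r u) = q1 |` (q2 |` (trace (r v) `&` trace (r u)))]
    & forall w q, w != v -> trace g q -> trace (r w) q ->
        [/\ ~ bend g q, ~ endpoint g q &
          forall w', w' != v -> ~ bend (r w') q /\ ~ endpoint (r w') q]].
Proof.
move=> [spl fin tri nob] uv [p [vp up]].
have vu : v != u by rewrite eq_sym.
have [nbv nev] := nob v u p vu (conj vp up) v.
have [nbu neu] := nob v u p vu (conj vp up) u.
have [[sv pv] [su pu]] := (spl v, spl u).
(* Bends of the curve of [u] are absent from [U]: they are excluded later because that curve is a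
   line near the crossing. *)
pose U q := ~ endpoint (r u) q /\ forall w, w != u -> w != v -> ~ trace (r w) q.
have Ne : \forall q \near p, ~ endpoint (r u) q.
  have : \forall q \near p, ~ [set r u 0; r u 1] q.
    apply: near_notin; last by move=> H; apply: neu; case: H; [left|right].
    apply: (accessible_finite_set_closed.1 _); last exact: finite_set2.
    by apply: hausdorff_accessible; exact: norm_hausdorff.
  by apply: filterS => q; apply: contra_not => -[]; [left|right].
have Nw : \forall q \near p, forall w, w != u -> w != v -> ~ trace (r w) q.
  have := @filter_forall (plane R) G (fun w q => w != u -> w != v -> ~ trace (r w) q) (nbhs p) _.
  apply => w.
  have [->|wu] := eqVneq w u; first exact: nearW.
  have [->|wv] := eqVneq w v; first exact: nearW.
  have : \forall q \near p, ~ trace (r w) q.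
    apply: near_notin.
      by apply: plane_closed_image => //; [exact: (spl w).1.1|exact: segment_compact].
    move=> wp; suff : set0 p by [].
    by rewrite -(tri v u w) // eq_sym.
  by apply: filterS.
have Up : \forall q \near p, U q by apply: filterS2 Ne Nw => q.
have [t0 [tau [D [E [[tau0 t00 t01] axis inj frame]]]]] :=
  crossing_frame sv pv su pu (fin v u vu) vp up nev nbv neu nbu Up.
have frame_v x y : `|x| <= 3 -> 0 <= y <= 1 -> trace (r v) (frame_point p D E x y) -> y = 0.
  by move=> x3 /andP[y0 y1]; have [] // := frame x y x3; rewrite ger0_norm.
have frame_w w x y : w != v -> `|x| <= 3 -> 0 <= y <= 1 ->
    trace (r w) (frame_point p D E x y) -> w = u /\ x = 0.
  move=> wv x3 /andP[y0 y1] wq; have [|_ uq [_ Uq] _] := frame x y x3.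
    by rewrite ger0_norm.
  have [wu|wu] := eqVneq w u; last by have := Uq w wu wv wq.
  by split => //; apply/uq; rewrite -wu.
have zero3 : `|0 : R| <= 3 by rewrite normr0.
have fu y : 0 <= y <= 1 -> trace (r u) (frame_point p D E 0 y).
  by move=> /andP[y0 y1]; have [|_ -> //] := frame 0 y zero3; rewrite ger0_norm.
pose g := finger (r v) t0 tau D E.
have old w q : w != v -> trace (r v) q -> trace (r w) q -> trace g q.
  move=> wv vq wq; have [//|[x [qE x3 /eqP x0]]] := trace_finger_old axis vq.
  by case: x0; rewrite qE in wq; apply: (frame_w _ _ _ wv x3 _ wq).2; rewrite lexx ler01.
have new w q : w != v -> trace g q -> trace (r w) q -> trace (r v) q \/
    w = u /\ exists2 y, y = 1 / 2 \/ y = 2 / 3 & q = frame_point p D E 0 y.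
  move=> wv gq wq; have [|[x [y [qE x3 y01 xy]]]] := trace_finger axis gq; first by left.
  rewrite qE in wq; have [wu x0] := frame_w _ _ _ wv x3 y01 wq.
  by right; split => //; exists y; [exact: xy|rewrite qE x0].
have height (y : R) : y = 1 / 2 \/ y = 2 / 3 -> 0 < y <= 1 by case=> ->; lra.
have offv y : y = 1 / 2 \/ y = 2 / 3 -> ~ trace (r v) (frame_point p D E 0 y).
  move=> /height/andP[y0 y1] vq; have := frame_v 0 y zero3.
  by rewrite (ltW y0) y1 => /(_ isT vq) y00; rewrite y00 ltxx in y0.
exists g; split.
- by split; [apply: finger_simple axis _ _|exact: finger_pl].
- move=> w wv wu; apply/seteqP; split => q [H1 H2]; split => //; last exact: old H1 H2.
  by have [//|[wu']] := new w q wv H1 H2; rewrite wu' eqxx in wu.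
- exists (frame_point p D E 0 (1 / 2)), (frame_point p D E 0 (2 / 3)); split.
  + by apply/eqP => /inj[_]; lra.
  + by apply: offv; left.
  + by apply: offv; right.
  + apply/seteqP; split => [q [gq uq]|q].
      have [vq|[_ [y [|] -> ->]]] := new u q uv gq uq.
      * by right; right.
      * by left.
      * by right; left.
    case=> [->|[->|[vq uq]]]; last by split => //; exact: old uq.
      by split; [apply: trace_finger_new => //; left|apply: fu; lra].
    by split; [apply: trace_finger_new => //; right|apply: fu; lra].
- move=> w q wv gq wq.
  have vw : v != w by rewrite eq_sym.
  split.
  + move=> /(finger_bend tau0 axis)[bq|[x [y [qE x3 y01 /eqP x0]]]].
      by have [] := nob v w q vw (conj (bend_trace bq) wq) v.
    by rewrite qE in wq; apply: x0; exact: (frame_w _ _ _ wv x3 y01 wq).2.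
  + move=> /(finger_endpoint tau0 t00 t01) eq.
    by have [] := nob v w q vw (conj (endpoint_trace eq) wq) v.
  + move=> w' wv'; have [vq|[wu [y yE qE]]] := new w q wv gq wq.
      exact: nob vw (conj vq wq) w'.
    have /andP[y0 y1] := height y yE.
    have [|_ _ [Ueq Uw] line] := frame 0 y zero3; first by rewrite gtr0_norm.
    rewrite -qE in Ueq Uw line.
    have [->|wu'] := eqVneq w' u.
      by split => //; apply: trace_line_no_bend line; exact: su.1.
    by split => [/bend_trace|/endpoint_trace]; exact: Uw.
Unshelve. all: by end_near. Qed.

Lemma card_eqU1 (T : Type) (A : set T) (x : T) n :
  ~ A x -> A #= `I_n -> x |` A #= `I_n.+1.
Proof.
move=> Ax An; apply/eq_cardSP; exists x; first by left.
rewrite (_ : _ `\ x = A)//; apply/seteqP; split => y; first by case=> -[].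
by move=> Ay; split; [right|move=> yx; rewrite yx in Ay].
Qed.

(* The intermediate stage of the induction: only the pairs in [L] have already
   received their two additional crossings. *)
Definition crossings (k : nat) (L : seq (G * G)) u v : nat :=
  if ((u, v) \in L) || ((v, u) \in L) then k.+2 else k.

(** Counts are asked for edges only; [string_representation] already makes the other pairs
    disjoint. *)
Definition crosses_exactly (m : G -> G -> nat) r : Prop :=
  [/\ string_representation r, proper_representation r &
    forall u v, u != v -> edge u v -> trace (r u) `&` trace (r v) #= `I_(m u v)].

Lemma crosses_exactly_ext m m' r : (forall u v, u != v -> edge u v -> m u v = m' u v) ->
  crosses_exactly m r -> crosses_exactly m' r.
Proof. by move=> mm' [? ? H]; split => // a b ab eab; rewrite -mm'//; exact: H. Qed.

Lemma crosses_exactly_add2 m r u v : u != v -> edge u v -> crosses_exactly m r ->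
  exists r', crosses_exactly
    (fun a b => if ((a, b) == (u, v)) || ((b, a) == (u, v)) then (m a b).+2 else m a b) r'.
Proof.
move=> uv euv [[cr er] pr num].
have ne : trace (r v) `&` trace (r u) !=set0 by rewrite setIC; apply/er.
have [g [[sg plg] same [q1 [q2 [q12 q1v q2v inter]]] nob']] := add_two_crossings pr uv ne.
case: (pr) => spl fin tri nob.
pose r' w := if w == v then g else r w.
have r'v : r' v = g by rewrite /r' eqxx.
have r'N w : w != v -> r' w = r w by rewrite /r' => /negbTE ->.
(* For a symmetric property it is enough to treat pairs that begin with [v] and pairs that avoid
   [v]. *)
have wlogv (P : G -> G -> Prop) : (forall a b, P a b -> P b a) ->
    (forall a, a != v -> P v a) -> (forall a b, a != v -> b != v -> a != b -> P a b) ->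
    forall a b, a != b -> P a b.
  move=> Psym Pv PN a b ab; have [av|av] := eqVneq a v.
    by rewrite av; apply: Pv; rewrite -av eq_sym.
  have [bv|bv] := eqVneq b v; first by rewrite bv; apply/Psym/Pv.
  exact: PN.
exists r'; split.
- split.
    by move=> w; rewrite /r'; case: ifP => _; [exact: sg.1|exact: cr].
  apply: wlogv => [a b|a av|a b av bv ab]; first by rewrite setIC edge_sym.
    rewrite r'v r'N//; have [->|au] := eqVneq a u.
      rewrite edge_sym inter; split => // _; exists q1; by left.
    by rewrite same// er// eq_sym.
  by rewrite !r'N// er.
- split.
  + by move=> w; rewrite /r'; case: ifP => _; [split|exact: spl].
  + apply: wlogv => [a b|a av|a b av bv ab]; first by rewrite setIC.
      rewrite r'v r'N//; have [->|au] := eqVneq a u.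
        by rewrite inter !finite_setU; do !split; [exact: finite_set1..|apply: fin; rewrite eq_sym].
      by rewrite same//; apply: fin; rewrite eq_sym.
    by rewrite !r'N//; exact: fin.
  (* Of two distinct curves met by [g] at least one is not that of [u]; with that one [g] has the
     same intersection as the old curve of [v], so the old triple condition applies. *)
  + have tv0 b c : b != v -> c != v -> b != c -> c != u ->
        trace g `&` trace (r b) `&` trace (r c) = set0.
      by move=> bv cv bc cu; rewrite setIAC same// tri// eq_sym.
    have tv b c : b != v -> c != v -> b != c -> trace g `&` trace (r b) `&` trace (r c) = set0.
      move=> bv cv bc; have [cu|] := eqVneq c u; last exact: tv0.
      by rewrite setIAC tv0 -?cu// eq_sym.
    move=> a b c ab ac bc.
    have [av|av] := eqVneq a v.
      by subst a; rewrite r'v !r'N//; [apply: tv|..]; rewrite // eq_sym.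
    have [bv|bv] := eqVneq b v.
      subst b; rewrite r'v !r'N//; last by rewrite eq_sym.
      by rewrite [trace (r a) `&` _]setIC; apply: tv => //; rewrite eq_sym.
    have [cv|cv] := eqVneq c v.
      subst c; rewrite r'v !r'N//.
      by rewrite setIC setIA; apply: tv.
    by rewrite !r'N//; apply: tri.
  + have key a b p : a != b -> (trace (r' a) `&` trace (r' b)) p ->
        (a != v /\ b != v) \/ exists2 c, c != v & trace g p /\ trace (r c) p.
      move=> ab [ap bp]; have [av|av] := eqVneq a v.
        have bv : b != v by rewrite -av eq_sym.
        by right; exists b => //; rewrite av r'v r'N// in ap bp.
      have [bv|bv] := eqVneq b v; last by left.
      by right; exists a => //; rewrite bv r'v r'N// in ap bp.
    move=> a b p ab abp; have [[av bv]|[c cv [gp cp]]] := key a b p ab abp; last first.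
      have [nbg neg_ nobw] := nob' c p cv gp cp.
      by move=> w; have [->|wv] := eqVneq w v; [rewrite r'v|rewrite r'N//; exact: nobw].
    have {}abp : (trace (r a) `&` trace (r b)) p by rewrite -(r'N a av) -(r'N b bv).
    move=> w; have [->|wv] := eqVneq w v; last by rewrite r'N//; exact: nob a b p ab abp w.
    rewrite r'v; split=> [bg|eg].
      by have [] := nob' a p av (bend_trace bg) abp.1.
    by have [] := nob' a p av (endpoint_trace eg) abp.1.
- have two n : trace (r v) `&` trace (r u) #= `I_n ->
      q1 |` (q2 |` (trace (r v) `&` trace (r u))) #= `I_n.+2.
    move=> num_n; apply: card_eqU1; last by apply: card_eqU1 => // -[].
    by case=> [q12E|[]//]; rewrite q12E eqxx in q12.
  move=> a b ab eab.
  have [av|av] := eqVneq a v.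
    have bv : b != v by rewrite -av eq_sym.
    subst a; rewrite r'v r'N//; have [bu|bu] := eqVneq b u.
      by subst b; rewrite eqxx orbT inter; apply/two/num.
    by rewrite !xpair_eqE eq_sym (negbTE uv) (negbTE bu) same// num.
  have [bv|bv] := eqVneq b v.
    subst b; rewrite setIC r'v r'N//; have [au|au] := eqVneq a u.
      subst a; rewrite eqxx inter; apply: two; rewrite setIC; exact: num.
    by rewrite !xpair_eqE (negbTE au) (negbTE av) andbF same// setIC num.
  by rewrite !r'N// !xpair_eqE (negbTE av) (negbTE bv) !andbF num.
Qed.

End Representation.

(** * Induction over the ordered pairs of vertices *)

Theorem proposition1 (R : realType) (k : nat) (G : sgraph) :
  (1 <= k)%N -> exact_string_graph R k G -> exact_string_graph R (k + 2)%N G.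
Proof.
move=> _ [r0 [sr0 pr0 ex0]].
have [r [sr pr num]] : exists r : G -> R -> plane R,
    crosses_exactly (crossings k (enum {: G * G})) r.
  elim: (enum _) => [|[u v] L [r rL]].
    exists r0; split => // u v uv euv.
    by have [e0|//] := ex0 u v uv; have /set0P := (sr0.2 u v uv).2 euv; rewrite e0 eqxx.
  (* An edge is listed in both orientations; the test on [L] lets only one of them trigger the
     move. *)
  have [/and4P[uv euv uvL vuL]|skip] :=
      boolP [&& u != v, edge u v, (u, v) \notin L & (v, u) \notin L].
    have [r' r'L] := crosses_exactly_add2 uv euv rL.
    exists r'; apply: crosses_exactly_ext r'L => a b ab eab.
    rewrite /crossings !inE; have [[-> ->]|abuv] := eqVneq (a, b) (u, v).
      by rewrite (negbTE uvL) (negbTE vuL).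
    have [[-> ->]|bauv] := eqVneq (b, a) (u, v).
      by rewrite orbT (negbTE uvL) (negbTE vuL).
    by [].
  exists r; apply: crosses_exactly_ext rL => a b ab eab; rewrite /crossings !inE.
  have [[au bv]|abuv] := eqVneq (a, b) (u, v).
    by move: skip; rewrite -au -bv ab eab -negb_or negbK /= => ->.
  have [[bu av]|//] := eqVneq (b, a) (u, v).
  by move: skip; rewrite -av -bu eq_sym ab edge_sym eab -negb_or negbK /= orbC => ->; rewrite orbT.
exists r; split => // u v uv; have [euv|neuv] := boolP (edge u v).
  by right; have := num u v uv euv; rewrite /crossings mem_enum addn2.
left; apply/eqP; apply: contraNT neuv => /set0P; exact: (sr.2 u v uv).1.
Qed.
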